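(* Let $G$ be a finite simple graph with at least two vertices that has no induced subgraph isomorphic to the path $P_4$ on four vertices. Then the prism $G \Box K_2$ has a hamiltonian cycle if and only if $G$ is $\frac{1}{2}$-tough.
   Context: For $S \subseteq V(G)$, $G-S$ is the subgraph induced on $V(G)-S$ and $c(H)$ denotes the number of components of a graph $H$. For a real $t\ge 0$, $G$ is $t$-tough if $|S| \ge t\cdot c(G-S)$ for every $S\subseteq V(G)$ with $c(G-S)\ge 2$. The prism over $G$ is the Cartesian product $G\Box K_2$: two copies of $G$ with the two copies of each vertex joined by an edge. $G$ is called prism-hamiltonian if $G \Box K_2$ is hamiltonian. *)

(* Defs.v *)
From HB Require Import structures.
From mathcomp Require Import all_boot all_order all_algebra.
From mathcomp Require Import reals.

Set Implicit Arguments.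
Unset Strict Implicit.
Unset Printing Implicit Defensive.

Record sgraph := SGraph {
  vertex :> finType;
  adj : rel vertex;
  adj_sym : symmetric adj;
  adj_irrefl : irreflexive adj
}.

Definition isomorphic (G H : sgraph) : Prop :=
  exists2 f : G -> H, bijective f & {mono f : x y / adj x y}.

Section Induced.
Variables (G : sgraph) (A : {set G}).

Definition induced_adj : rel {x : G | x \in A} :=
  [rel x y | adj (val x) (val y)].

Lemma induced_adj_sym : symmetric induced_adj.
Proof. by move=> x y; apply: adj_sym. Qed.

Lemma induced_adj_irrefl : irreflexive induced_adj.
Proof. by move=> x; apply: adj_irrefl. Qed.

Definition induced : sgraph := SGraph induced_adj_sym induced_adj_irrefl.
End Induced.

Section Path.
Variable n : nat.

Definition path_adj : rel 'I_n := [rel i j : 'I_n | (i.+1 == j) || (j.+1 == i)].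

Lemma path_adj_sym : symmetric path_adj.
Proof. by move=> i j; rewrite /path_adj /= orbC. Qed.

Lemma path_adj_irrefl : irreflexive path_adj.
Proof. by move=> i; rewrite /path_adj /= orbb gtn_eqF. Qed.

Definition path_graph : sgraph := SGraph path_adj_sym path_adj_irrefl.
End Path.

Section Complete.
Variable n : nat.

Definition complete_adj : rel 'I_n := [rel i j : 'I_n | i != j].

Lemma complete_adj_sym : symmetric complete_adj.
Proof. by move=> i j; rewrite /complete_adj /= eq_sym. Qed.

Lemma complete_adj_irrefl : irreflexive complete_adj.
Proof. by move=> i; rewrite /complete_adj /= eqxx. Qed.

Definition complete_graph : sgraph :=
  SGraph complete_adj_sym complete_adj_irrefl.
End Complete.

Section CartesianProduct.
Variables G H : sgraph.

Definition cartesian_adj : rel (G * H) :=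
  [rel u v | (u.1 == v.1) && adj u.2 v.2 || (u.2 == v.2) && adj u.1 v.1].

Lemma cartesian_adj_sym : symmetric cartesian_adj.
Proof.
by move=> u v; rewrite /cartesian_adj /= (eq_sym u.1) (eq_sym u.2);
rewrite (adj_sym u.1) (adj_sym u.2).
Qed.

Lemma cartesian_adj_irrefl : irreflexive cartesian_adj.
Proof. by move=> u; rewrite /cartesian_adj /= !adj_irrefl !andbF. Qed.

Definition cartesian_product : sgraph :=
  SGraph cartesian_adj_sym cartesian_adj_irrefl.
End CartesianProduct.

Definition prism (G : sgraph) : sgraph :=
  cartesian_product G (complete_graph 2).

(* The bound [2 < size p] rules out the degenerate closed walks on at most two
   vertices, which satisfy [cycle] and [uniq] but are not graph cycles. *)
Definition hamiltonian (G : sgraph) : Prop :=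
  exists p : seq G,
    [/\ 2 < size p, uniq p, cycle (@adj G) p & forall x : G, x \in p].

Definition num_components (G : sgraph) : nat := n_comp (@adj G) predT.

Definition delete (G : sgraph) (S : {set G}) : sgraph := induced (~: S).

Definition tough (R : realType) (t : R) (G : sgraph) : Prop :=
  forall S : {set G}, 2 <= num_components (delete S) ->
    (t * (num_components (delete S))%:R <= #|S|%:R)%R.

Definition induced_free (H G : sgraph) : Prop :=
  forall A : {set G}, ~ isomorphic (induced A) H.

(* Main.v *)
Require Import Defs.
From HB Require Import structures.
From mathcomp Require Import all_boot all_order all_algebra.
From mathcomp Require Import reals.
From mathcomp Require Import zify.

(** A hamiltonian cycle of the prism leaves every component of [G - S] through
    one of the [2|S|] vertices over [S], whence [1/2]-toughness.

    Conversely, [P4]-free graphs are built from single vertices by disjoint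
    unions and joins.  Along this construction every nonempty vertex set [A]
    has a number [q] such that the prism over [A] is covered by [k] disjoint
    paths, each going from the lower to the upper level, for all
    [q <= k <= |A|], and some [S] satisfies [c(A - S) >= q + 2|S|].  In a join
    of [X] and [Y] with [|Y| <= |X|] a vertex of [Y] merges two paths over [X]
    (traversing its fiber in between) or three (its two copies linking the
    ends, the middle path reversed), which lowers [q] by up to [2|Y|].  If the
    whole graph is the join, toughness gives [q <= 2|Y|] and the paths over [X]
    close up to a hamiltonian cycle. *)

Set Implicit Arguments.
Unset Strict Implicit.
Unset Printing Implicit Defensive.

(** * Decomposing [P4]-free relations into disjoint unions and joins *)

Section Splitting.
Variable T : finType.
Implicit Types (e : rel T) (A X Y : {set T}).

(** Stated for a bare relation rather than an [sgraph], so that it also applies to [rel_compl e],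
    which may have loops. *)
Definition P4_free e := forall a b c d, uniq [:: a; b; c; d] ->
  e a b -> e b c -> e c d -> ~~ e a c -> ~~ e a d -> ~~ e b d -> False.

(** A decomposition of [A] as a disjoint union; for [rel_compl e] it is a join. *)
Definition splits e A X Y :=
  [/\ X != set0, Y != set0, X :|: Y = A, [disjoint X & Y] &
      {in X & Y, forall x y, ~~ e x y}].

Definition rel_compl e : rel T := fun x y => ~~ e x y.

(** [P4] is self-complementary: an induced path [a b c d] of the complement is the induced path
    [b d a c] of [e]. *)
Lemma P4_free_compl e : symmetric e -> P4_free e -> P4_free (rel_compl e).
Proof.
move=> e_sym Pe a b c d u; rewrite /rel_compl !negbK => ab bc cd ac ad bd.
have da : e d a by rewrite e_sym.
have ba : ~~ e b a by rewrite e_sym.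
have dc : ~~ e d c by rewrite e_sym.
apply: (Pe b d a c) => //; move: u; rewrite /= !inE !negb_or.
rewrite (eq_sym d a) (eq_sym d c) (eq_sym b a) !andbT.
by case/and3P=> /and3P[-> -> ->] /andP[-> ->] ->.
Qed.

Lemma splits_sym e A X Y : symmetric e -> splits e A X Y -> splits e A Y X.
Proof.
move=> e_sym [X0 Y0 XY dXY nXY]; split; rewrite 1?setUC 1?disjoint_sym //.
by move=> x y Yx Xy; rewrite e_sym nXY.
Qed.

Lemma splits_compl_setU1 e A v : symmetric e -> v \notin A -> A != set0 ->
  {in A, forall x, e v x} -> splits (rel_compl e) (v |: A) [set v] A.
Proof.
move=> e_sym vA A0 ev; split=> //.
- by apply/set0Pn; exists v; rewrite inE.
- by rewrite disjoints1.
- by move=> x y /set1P-> /ev; rewrite /rel_compl negbK.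
Qed.

(* Either [v] can be added to one side of the split, or it dominates [A], or
   the non-neighbours of [v] in [X] can be split off: an edge from one of them
   to a neighbour of [v] in [X] would extend through [v] to [Y] as a [P4]. *)
Lemma splits_setU1 e A X Y v : symmetric e -> P4_free e -> v \notin A ->
  splits e A X Y ->
  exists X' Y', splits e (v |: A) X' Y' \/ splits (rel_compl e) (v |: A) X' Y'.
Proof.
move=> e_sym Pe vA.
have [allA|] := boolP [forall x in A, e v x].
  move=> [X0 _ XY _ _]; exists [set v], A; right.
  apply: splits_compl_setU1 => //; last by move=> x Ax; apply: (forall_inP allA).
  by apply: contra_neq X0 => A0; apply/eqP; rewrite -subset0 -A0 -XY subsetUl.
rewrite negb_forall_in => /exists_inP[w Aw vw].
wlog Xw : X Y / w \in X.
  move=> IH sXY; have [_ _ XY _ _] := sXY.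
  have : w \in X :|: Y by rewrite XY.
  rewrite inE => /orP[Xw|Yw]; first exact: (IH X Y).
  by apply: (IH Y X) => //; apply: splits_sym.
move=> [X0 Y0 XY dXY nXY].
have XA : X \subset A by rewrite -XY subsetUl.
have YA : Y \subset A by rewrite -XY subsetUr.
have vX : v \notin X by apply: contra vA; apply: (subsetP XA).
have vY : v \notin Y by apply: contra vA; apply: (subsetP YA).
have [/exists_inP[y Yy vy]|/exists_inPn noY] := boolP [exists y in Y, e v y];
  last first.
  exists (v |: X), Y; left; split=> //.
  - by apply/set0Pn; exists v; rewrite setU11.
  - by rewrite -XY setUA.
  - apply/pred0P=> z /=; rewrite in_setU1.
    by case: eqP => [->|_]; [apply: negbTE | apply: (pred0P dXY)].
  - move=> x z; rewrite in_setU1 => /orP[/eqP->|]; first exact: noY.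
    exact: nXY.
pose C := [set x in X | ~~ e v x].
exists C, ((v |: A) :\: C); left; split.
- by apply/set0Pn; exists w; rewrite inE Xw.
- by apply/set0Pn; exists v; rewrite !inE eqxx (negPf vX).
- apply/setP=> x; rewrite !inE.
  by have [Xx|] := boolP (x \in X); rewrite //= (subsetP XA) // orbT andbT orbN.
- rewrite -setI_eq0; apply/eqP/setP=> x; rewrite !inE.
  by case: (x \in X); case: (e v x).
move=> c x; rewrite !inE => /andP[Xc vc] /andP[xC /orP[/eqP->|Ax]].
  by rewrite e_sym.
have : x \in X :|: Y by rewrite XY.
rewrite inE => /orP[Xx|Yx]; last exact: nXY.
move: xC; rewrite Xx /= negbK => vx; apply/negP => cx.
have cv : c != v by apply: contraNneq vX => <-.
have xv : x != v by apply: contraNneq vX => <-.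
have yv : y != v by apply: contraNneq vY => <-.
have ny z : z \in X -> z != y.
  by move=> Xz; apply: contraTneq Yy => <-; rewrite (disjointFr dXY).
have xv' : e x v by rewrite e_sym.
have cv' : ~~ e c v by rewrite e_sym.
apply: (Pe c x v y) => //; try exact: nXY.
rewrite /= !inE !negb_or cv xv (eq_sym v) yv !ny //= !andbT.
by apply: contraNneq vc => ->.
Qed.

(** By induction: a split of [A :\ v], in [e] or in its complement, is extended to [v] by
    [splits_setU1]. *)
Lemma P4_free_splits e A : symmetric e -> P4_free e -> 1 < #|A| ->
  exists X Y, splits e A X Y \/ splits (rel_compl e) A X Y.
Proof.
move=> e_sym Pe.
have c_sym : symmetric (rel_compl e) by move=> x y; rewrite /rel_compl e_sym.
move: {2}#|A| (leqnn #|A|) => n; elim: n A => [|n IH] A; first by lia.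
move=> leA A1; have [v Av] : exists v, v \in A by apply/card_gt0P; lia.
have vA : v \notin A :\ v by rewrite setD11.
have defA : v |: (A :\ v) = A by rewrite setD1K.
have cardA : #|A| = #|A :\ v|.+1 by rewrite (cardsD1 v A) Av.
have [A'1|A'1] := leqP #|A :\ v| 1.
  have /cards1P[w defw] : #|A :\ v| == 1 by lia.
  have [vw|vw] := boolP (e v w).
    exists [set v], (A :\ v); right; rewrite -{1}defA.
    apply: splits_compl_setU1; rewrite // defw.
      by apply/set0Pn; exists w; rewrite inE.
    by move=> x /set1P->.
  exists [set v], (A :\ v); left; split=> //.
  - by apply/set0Pn; exists v; rewrite inE.
  - by rewrite -card_gt0; lia.
  - by rewrite disjoints1.
  - by move=> x y; rewrite defw => /set1P-> /set1P->.
have [||X [Y [sXY|sXY]]] := IH (A :\ v); [lia|lia| |].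
  by have := splits_setU1 e_sym Pe vA sXY; rewrite defA.
(* For the complement the two outcomes trade places, since complementing twice gives [e] back. *)
have [X' [Y' []]] := splits_setU1 c_sym (P4_free_compl e_sym Pe) vA sXY;
  rewrite defA => s'; exists X', Y'; [by right | left].
case: s' => ? ? ? ? n'; split=> // x y Xx Yy.
by have := n' x y Xx Yy; rewrite /rel_compl negbK.
Qed.

End Splitting.

Lemma induced_P4_free (G : sgraph) :
  induced_free (path_graph 4) G -> P4_free (@adj G).
Proof.
move=> Gfree a b c d u ab bc cd ac ad bd.
pose s := [:: a; b; c; d]; apply: (Gfree [set x in s]).
have sz (x : {x : G | x \in [set x in s]}) : index (val x) s < 4.
  by rewrite -[4]/(size s) index_mem; have := valP x; rewrite inE.
have mem_s (i : 'I_4) : nth a s i \in [set x in s] by rewrite inE mem_nth.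
exists (fun x => Ordinal (sz x) : path_graph 4).
  exists (fun i : 'I_4 => exist _ (nth a s i) (mem_s i)) => [x|i].
    by apply: val_inj; rewrite /= nth_index //; have := valP x; rewrite inE.
  by apply: (@val_inj _ _ 'I_4); apply: (@index_uniq _ a i s (ltn_ord i) u).
move=> x y; change ((((index (val x) s).+1 == index (val y) s) ||
  ((index (val y) s).+1 == index (val x) s)) = adj (val x) (val y)).
have /(nthP a)[i si <-] : val x \in s by have := valP x; rewrite inE.
have /(nthP a)[j sj <-] : val y \in s by have := valP y; rewrite inE.
rewrite !index_uniq //; move: i j si sj.
by move=> [|[|[|[|//]]]] [|[|[|[|//]]]] /= _ _;
   rewrite ?adj_irrefl ?ab ?bc ?cd ?(negPf ac) ?(negPf ad) ?(negPf bd) //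
     adj_sym ?ab ?bc ?cd ?(negPf ac) ?(negPf ad) ?(negPf bd).
Qed.

(* A certificate that [U] induces at least [t] components. *)
Definition separated (G : sgraph) (U : {set G}) (t : nat) :=
  exists f : G -> nat,
    {in U &, forall x y, adj x y -> f x = f y} /\
    forall i, i < t -> exists2 x, x \in U & f x = i.

(** * Counting components, and the necessity of toughness *)

Section Components.
Variable G : sgraph.
Implicit Types (S U : {set G}) (x y : G).

Lemma connect_adj_sym (H : sgraph) : connect_sym (@adj H).
Proof. exact/sym_connect_sym/adj_sym. Qed.

(** The labelling is constant on components, so vertices with different labels have different
    roots. *)
Lemma separated_leq_num_components S t :
  separated (~: S) t -> t <= num_components (delete S).
Proof.
move=> [f [f_adj f_onto]].
have f_root (x : delete S) : f (val (fingraph.root (@adj (delete S)) x)) = f (val x).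
  have /connectP[p] := connect_root (@adj (delete S)) x.
  move: (fingraph.root _ x) => r; elim: p x => [|y p IH] x /=; first by move=> _ ->.
  case/andP=> xy py /(IH _ py) ->; apply: f_adj; rewrite ?(valP y) ?(valP x) //.
  by rewrite adj_sym.
have x_of (i : 'I_t) : {x : delete S | f (val x) == i}.
  apply: sigW; have [x Sx fx] := f_onto i (ltn_ord i).
  by exists (exist _ x Sx); apply/eqP.
pose g (i : 'I_t) := fingraph.root (@adj (delete S)) (sval (x_of i)).
have g_inj : injective g.
  move=> i j /(congr1 (fun r => f (val r))); rewrite !f_root !(eqP (svalP (x_of _))).
  exact: val_inj.
rewrite -{1}(card_ord t) -(card_codom g_inj).
apply: subset_leq_card; apply/subsetP=> r /codomP[i ->].
by rewrite !inE roots_root //; apply: connect_adj_sym.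
Qed.

Lemma separated1 U x : x \in U -> separated U 1.
Proof. by move=> Ux; exists (fun=> 0); split=> // -[]// _; exists x. Qed.

(** The labels on [U2] are shifted by [t1], to supply those from [t1] on. *)
Lemma separatedU U1 U2 t1 t2 : [disjoint U1 & U2] ->
  {in U1 & U2, forall x y, ~~ adj x y} ->
  separated U1 t1 -> separated U2 t2 -> separated (U1 :|: U2) (t1 + t2).
Proof.
move=> d12 n12 [f1 [a1 s1]] [f2 [a2 s2]].
exists (fun x => if x \in U1 then f1 x else t1 + f2 x); split=> [x y|i lt_i].
  rewrite !inE; case: ifP => /= [x1 _|_ x2]; case: ifP => /= [y1 _|_ y2] xy.
  - exact: a1.
  - by have := n12 x y x1 y2; rewrite xy.
  - by have := n12 y x y1 x2; rewrite adj_sym xy.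
  - by rewrite (a2 x y).
have [lt_i1|le_i1] := ltnP i t1.
  by have [x x1 <-] := s1 i lt_i1; exists x; rewrite ?inE x1.
have [|x x2 fx] := s2 (i - t1); first by lia.
by exists x; rewrite ?inE ?x2 ?orbT // (disjointFl d12 x2) fx subnKC.
Qed.


(* Every component of [G - S] is left by the cycle, and the vertex following
   the exit lies over [S]; distinct components have distinct exits. *)
Lemma hamiltonian_prism_num_components S : hamiltonian (prism G) ->
  1 < num_components (delete S) -> num_components (delete S) <= #|S| * 2.
Proof.
move=> [p [_ uniq_p cycle_p mem_p]] comp_gt1.
pose e := @adj (delete S).
have e_sym : connect_sym e := @connect_adj_sym (delete S).
pose over (r : delete S) (w : prism G) :=
  [exists x : delete S, (val x == w.1) && connect e r x].
have exitP (r : delete S) : r \in roots e ->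
    exists w, over r w && ((next p w).1 \in S).
  (* Without an exit the cycle stays over the component of [r]; as it visits every vertex, there is
     only this component. *)
  move=> root_r; apply/existsP; apply: contraLR comp_gt1 => /existsPn no_exit.
  have over_next w : over r w -> over r (next p w).
    move=> ow; have := no_exit w; rewrite ow /= -in_setC => nS.
    have [x /andP[/eqP xw rx]] := existsP ow.
    have := next_cycle cycle_p (mem_p w).
    move=> /orP[/andP[/eqP eqw _]|/andP[_ adjw]].
      by apply/existsP; exists x; rewrite xw eqw eqxx.
    apply/existsP; exists (exist _ (next p w).1 nS); rewrite eqxx /=.
    by apply: connect_trans rx (connect1 _); rewrite /e /= /induced_adj /= xw.
  pose r0 : prism G := (val r, ord0).
  have over_all w : over r w.
    have : fconnect (next p) r0 w.
      by rewrite (fconnect_cycle (cycle_next uniq_p)).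
    move/iter_findex <-; elim: findex => [|n IH] /=; last exact: over_next.
    by apply/existsP; exists r; rewrite eqxx connect0.
  rewrite -leqNgt -(card1 r); apply: subset_leq_card; apply/subsetP=> s.
  rewrite !inE andbT => /eqP <-.
  have [x /andP[/eqP/val_inj-> rx]] := existsP (over_all (val s, ord0)).
  by rewrite -(eqP root_r); apply/eqP/esym/fingraph.rootP.
(* Non-roots get an arbitrary vertex, which makes the choice of exits a total function. *)
have exit_of (r : delete S) :
    {w | r \in roots e -> over r w && ((next p w).1 \in S)}.
  have [/exitP/sigW[w ?]|nr] := boolP (r \in roots e); first by exists w.
  by exists (val r, ord0).
pose g r := next p (sval (exit_of r)).
have g_inj : {in [predI roots e & predT] &, injective g}.
  move=> r s /andP[Rr _] /andP[Rs _] /(can_inj (prev_next uniq_p)) eqw.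
  have /andP[/existsP[x /andP[/eqP xw rx]] _] := svalP (exit_of r) Rr.
  have /andP[/existsP[y /andP[/eqP yw sy]] _] := svalP (exit_of s) Rs.
  rewrite -(eqP Rr) -(eqP Rs); apply/fingraph.rootP => //.
  rewrite (connect_trans rx) // e_sym.
  suff -> : x = y by [].
  by apply: val_inj; rewrite xw yw eqw.
rewrite /num_components /n_comp_mem -/e -(card_in_image g_inj).
(* [#|S| * 2] becomes the number of prism vertices over [S], where [g] takes its values on roots. *)
rewrite -[2]card_ord -cardsT -cardsX; apply: subset_leq_card.
apply/subsetP=> w /imageP[r /andP[Rr _] ->]; rewrite !inE andbT.
by have /andP[] := svalP (exit_of r) Rr.
Qed.

End Components.

(** * Paths with prescribed ends *)

Section PathBetween.
Variable H : sgraph.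
Implicit Types (x y : H) (p q : seq H).

Definition path_between x y p :=
  exists q, [/\ p = x :: q, path (@adj H) x q & last x q = y].

Lemma path_between1 x : path_between x x [:: x].
Proof. by exists [::]. Qed.

Lemma path_between_cat x y x' y' p p' : path_between x y p ->
  path_between x' y' p' -> adj y x' -> path_between x y' (p ++ p').
Proof.
move=> [q [-> pq <-]] [q' [-> pq' <-]] yx'; exists (q ++ x' :: q').
by rewrite cat_path /= pq yx' last_cat.
Qed.

Lemma path_between_rev x y p : path_between x y p -> path_between y x (rev p).
Proof.
move=> [q [-> pq <-]]; exists (rev (belast x q)); rewrite lastI rev_rcons.
split=> //.
  by rewrite rev_path; apply: sub_path pq => ? ?; rewrite adj_sym.
by case: q {pq} => //= z q; rewrite rev_cons last_rcons.
Qed.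

Lemma path_between_cycle x y p :
  path_between x y p -> adj y x -> cycle (@adj H) p.
Proof. by move=> [q [-> pq <-]] yx; rewrite /= rcons_path pq. Qed.

End PathBetween.

(** * Rising paths and fibers in the prism *)

Section PrismPaths.
Variable G : sgraph.
Implicit Types (A B E : {set G}) (b u v : G) (x y : prism G).
Implicit Types (p : seq (prism G)) (ps : seq (seq (prism G))) (bs : seq G).

Definition low v : prism G := (v, ord0).
Definition high v : prism G := (v, ord_max).

(** Only the ends are confined to [E]: a new vertex is attached at the ends, while the inner
    vertices may lie anywhere. *)
Definition rising E p :=
  exists u v, [/\ u \in E, v \in E & path_between (low u) (high v) p].

Definition fibers bs := flatten [seq [:: low b; high b] | b <- bs].

Lemma adj_low_high b : adj (low b) (high b).
Proof. by rewrite /= /cartesian_adj /= eqxx. Qed.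

Lemma adj_low u v : adj (low u) (low v) = adj u v.
Proof. by rewrite /= /cartesian_adj /= /complete_adj /= andbF. Qed.

Lemma adj_high u v : adj (high u) (high v) = adj u v.
Proof. by rewrite /= /cartesian_adj /= /complete_adj /= andbF. Qed.

Lemma rising_sub A B p : A \subset B -> rising A p -> rising B p.
Proof. by move=> /subsetP sAB [u [v [/sAB Bu /sAB Bv uv]]]; exists u, v. Qed.

Lemma rising_fiber E b : b \in E -> rising E [:: low b; high b].
Proof.
move=> Eb; exists b, b; split=> //.
exact: (path_between_cat (path_between1 _) (path_between1 _) (adj_low_high b)).
Qed.

Lemma perm_fibers bs bs' : perm_eq bs bs' -> perm_eq (fibers bs) (fibers bs').
Proof. by move=> eq_bs; apply/perm_flatten/perm_map. Qed.

Lemma mem_fibers bs x : (x \in fibers bs) = (x.1 \in bs).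
Proof.
apply/flatten_mapP/idP => [[b b_bs]|x_bs].
  by rewrite !inE => /orP[] /eqP->.
exists x.1; rewrite // !inE; case: x {x_bs} => v [[|[|//]] i] /=.
  by apply/orP; left; apply/eqP; congr (_, _); apply: val_inj.
by apply/orP; right; apply/eqP; congr (_, _); apply: val_inj.
Qed.

Lemma uniq_fibers bs : uniq bs -> uniq (fibers bs).
Proof.
elim: bs => //= b bs IH /andP[b_bs /IH u_bs]; rewrite inE negb_or !mem_fibers.
by rewrite b_bs andbT; apply/andP; split=> //; apply/eqP => -[].
Qed.

(* Otherwise simplification rewrites [vertex (prism G)] in only some of the
   types, and [lia] no longer identifies the sizes. *)
Local Opaque prism.

(** * Absorbing the fibers of dominating vertices *)

Section Absorb.
Variable A : {set G}.

Definition dominates b := {in A, forall u, adj b u}.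

Lemma rising_join2 b p1 p2 : dominates b -> rising A p1 -> rising A p2 ->
  rising A (p1 ++ [:: high b; low b] ++ p2).
Proof.
move=> domb [u1 [v1 [Au1 Av1 P1]]] [u2 [v2 [Au2 Av2 P2]]].
exists u1, v2; split=> //; rewrite /= -cat1s -(cat1s (low b)).
have P2' := path_between_cat (path_between1 (low b)) P2.
have P2'' := path_between_cat (path_between1 (high b)) (P2' _).
apply: (path_between_cat P1 (P2'' _ _)).
- by rewrite adj_low domb.
- by rewrite adj_sym adj_low_high.
- by rewrite adj_high adj_sym domb.
Qed.

(** [high b] links the upper ends of [p1] and [p2], and [low b] the lower ends of [p2] and [p3]. *)
Lemma rising_join3 b p1 p2 p3 : dominates b ->
  rising A p1 -> rising A p2 -> rising A p3 ->
  rising A (p1 ++ high b :: rev p2 ++ low b :: p3).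
Proof.
move=> domb [u1 [v1 [Au1 Av1 P1]]] [u2 [v2 [Au2 Av2 P2]]] [u3 [v3 [Au3 Av3 P3]]].
exists u1, v3; split=> //; rewrite /= -cat1s -(cat1s (low b)).
have P3' := path_between_cat (path_between1 (low b)) P3.
have P2' := path_between_cat (path_between_rev P2) (P3' _).
have P2'' := path_between_cat (path_between1 (high b)) (P2' _ _).
apply: (path_between_cat P1 (P2'' _ _ _)).
- by rewrite adj_low domb.
- by rewrite adj_low adj_sym domb.
- by rewrite adj_high domb.
- by rewrite adj_high adj_sym domb.
Qed.

(** This absorbs [b] without changing the number of paths, but moves the ends to [b]. *)
Lemma rising_wrap E b p : dominates b -> b \in E -> rising A p ->
  rising E (low b :: p ++ [:: high b]).
Proof.
move=> domb Eb [u [v [Au Av P]]]; exists b, b; split=> //; rewrite -cat1s.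
have P' := path_between_cat P (path_between1 (high b)).
apply: (path_between_cat (path_between1 _) (P' _)).
- by rewrite adj_high adj_sym domb.
- by rewrite adj_low domb.
Qed.

(** Each vertex of [bs] merges two or three paths, lowering their number by 1 or 2, and all ends
    stay in [A]. *)
Lemma absorb_all bs ps k :
  {in bs, forall b, dominates b} -> {in ps, forall p, rising A p} ->
  size bs < size ps -> 0 < k ->
  size ps - 2 * size bs <= k <= size ps - size bs ->
  exists ps', [/\ size ps' = k, {in ps', forall p, rising A p} &
    perm_eq (flatten ps') (fibers bs ++ flatten ps)].
Proof.
elim: bs ps => [|b bs IH] ps dom_bs ris_ps lt_sz k_gt0 /=.
  by move=> le_k; exists ps; split=> //; lia.
have domb : dominates b by apply: dom_bs; rewrite mem_head.
have {}dom_bs : {in bs, forall b, dominates b}.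
  by move=> c c_bs; apply: dom_bs; rewrite inE c_bs orbT.
case: ps ris_ps lt_sz => [|p1 [|p2 ps]] //= ris_ps lt_sz le_k.
have r1 : rising A p1 by apply: ris_ps; rewrite !inE eqxx.
have r2 : rising A p2 by apply: ris_ps; rewrite !inE eqxx orbT.
have rps : {in ps, forall p, rising A p}.
  by move=> p p_ps; apply: ris_ps; rewrite !inE p_ps !orbT.
(* Two paths are merged as long as [k] exceeds the lower bound. At the bound every vertex has to
   merge three, and [0 < k] guarantees a third path. *)
have [lt_k|ge_k] := ltnP ((size ps).+2 - 2 * (size bs).+1) k.
  have [|||ps' [sz' r' perm']] :=
    IH ((p1 ++ [:: high b; low b] ++ p2) :: ps) dom_bs _ _ k_gt0.
  - by move=> p /[!inE] /predU1P[->|/rps//]; apply: rising_join2.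
  - by move=> /=; lia.
  - by move=> /=; lia.
  exists ps'; split=> //; apply: (perm_trans perm'); apply/permP => a.
  by rewrite /fibers /= ?count_cat /= ?count_cat /=; lia.
case: ps ris_ps rps lt_sz le_k ge_k => [|p3 ps] /= ris_ps rps lt_sz le_k ge_k.
  by lia.
have r3 : rising A p3 by apply: rps; rewrite !inE eqxx.
have [|||ps' [sz' r' perm']] :=
  IH ((p1 ++ high b :: rev p2 ++ low b :: p3) :: ps) dom_bs _ _ k_gt0.
- move=> p /[!inE] /predU1P[->|p_ps]; first exact: rising_join3.
  by apply: rps; rewrite inE p_ps orbT.
- by move=> /=; lia.
- by move=> /=; lia.
exists ps'; split=> //; apply: (perm_trans perm'); apply/permP => a.
by rewrite /fibers /= ?count_cat /= ?count_cat /= ?count_cat count_rev /=; lia.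
Qed.

(** Besides merging, a vertex can be wrapped around a path or contribute its fiber as a new path, so
    it changes the number of paths by anything from -2 to 1. *)
Lemma absorb E bs ps k : A \subset E -> {subset bs <= E} ->
  {in bs, forall b, dominates b} -> {in ps, forall p, rising A p} ->
  size bs <= size ps -> 0 < k ->
  size ps - 2 * size bs <= k <= size ps + size bs ->
  exists ps', [/\ size ps' = k, {in ps', forall p, rising E p} &
    perm_eq (flatten ps') (fibers bs ++ flatten ps)].
Proof.
move=> sAE; elim: bs ps k => [|b bs IH] ps k sbE dom_bs ris_ps /= le_sz k_gt0.
  move=> le_k; exists ps; split=> //; first by lia.
  by move=> p /ris_ps; apply: rising_sub.
move=> le_k.
have [le_kA|gt_kA] := leqP k (size ps - (size bs).+1).
  have [||ps' [sz' r' perm']] := @absorb_all (b :: bs) ps k dom_bs ris_ps _ k_gt0.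
  - by move=> /=; lia.
  - by move=> /=; lia.
  by exists ps'; split=> // p /r'; apply: rising_sub.
have domb : dominates b by apply: dom_bs; rewrite mem_head.
have Eb : b \in E by apply: sbE; rewrite mem_head.
have {}dom_bs : {in bs, forall b, dominates b}.
  by move=> c c_bs; apply: dom_bs; rewrite inE c_bs orbT.
have {}sbE : {subset bs <= E}.
  by move=> c c_bs; apply: sbE; rewrite inE c_bs orbT.
(* Here the other vertices merge down to [k] paths, and [b] is wrapped around one of them. Wrapping
   comes last, because the new ends need not be dominated. *)
have [kE|k_neq] := eqVneq k (size ps - size bs).
  have [||[|p ps'] [sz' r' perm']] := absorb_all dom_bs ris_ps _ k_gt0.
  - by lia.
  - by lia.
  - by move: k_gt0; rewrite -sz'.
  exists ((low b :: p ++ [:: high b]) :: ps'); split=> //.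
    move=> q /[!inE] /predU1P[->|q_ps'].
      by apply: rising_wrap => //; apply: r'; rewrite mem_head.
    by apply: (rising_sub sAE); apply: r'; rewrite inE q_ps' orbT.
  apply/permP => a; move/permP/(_ a): perm'; rewrite /fibers /= ?count_cat /= ?count_cat /=.
  by lia.
have [|||ps' [sz' r' perm']] := IH ps k.-1 sbE dom_bs ris_ps.
- by lia.
- by lia.
- by lia.
exists ([:: low b; high b] :: ps'); split=> //=; first by rewrite sz'; lia.
  by move=> p /[!inE] /predU1P[->|/r' //]; apply: rising_fiber.
by rewrite !perm_cons.
Qed.

End Absorb.

(** * Covering the prism over a set by a given number of paths *)

(** The permutation says at once that the paths are disjoint and that they fill exactly the prism
    over [A]. *)
Definition coverable A k := exists ps,
  [/\ size ps = k, {in ps, forall p, rising A p} &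
      perm_eq (flatten ps) (fibers (enum A))].

Lemma fibers_cat bs bs' : fibers (bs ++ bs') = fibers bs ++ fibers bs'.
Proof. by rewrite /fibers map_cat flatten_cat. Qed.

Lemma perm_fibersU A B : [disjoint A & B] ->
  perm_eq (fibers (enum B) ++ fibers (enum A)) (fibers (enum (A :|: B))).
Proof.
move=> dAB; rewrite -fibers_cat; apply: perm_fibers.
apply: uniq_perm; rewrite ?cat_uniq ?enum_uniq ?andbT //=.
  by apply/hasPn => v; rewrite !mem_enum => /(disjointFr dAB) ->.
by move=> v; rewrite mem_cat !mem_enum inE orbC.
Qed.

Lemma coverable1 v : coverable [set v] 1.
Proof.
exists [:: [:: low v; high v]]; split=> //; last by rewrite enum_set1.
by move=> p /[!inE] /eqP ->; apply: rising_fiber; rewrite set11.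
Qed.

Lemma coverableU A B k l : [disjoint A & B] ->
  coverable A k -> coverable B l -> coverable (A :|: B) (k + l).
Proof.
move=> dAB [ps [szA rA pA]] [qs [szB rB pB]]; exists (qs ++ ps); split.
- by rewrite size_cat szA szB addnC.
- move=> p; rewrite mem_cat => /orP[/rB|/rA]; apply: rising_sub.
    exact: subsetUr.
  exact: subsetUl.
by rewrite flatten_cat -(permPr (perm_fibersU dAB)) perm_cat.
Qed.

Lemma coverable_join A B k q : [disjoint A & B] ->
  {in B & A, forall b u, adj b u} -> #|B| <= #|A| -> q <= #|A| ->
  (forall j, q <= j <= #|A| -> coverable A j) ->
  0 < k -> q - 2 * #|B| <= k <= #|A| + #|B| -> coverable (A :|: B) k.
Proof.
move=> dAB domAB leBA leqA covA k_gt0 le_k.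
(* [j] is the number of paths over [A] to start from: all [#|A|] fibers if they can be merged down
   to [k], and otherwise the [k + 2 * #|B|] paths that triple merges reduce to [k]. *)
have [j [le_j leBj le_k']] : exists j, [/\ q <= j <= #|A|, #|B| <= j &
    j - 2 * #|B| <= k <= j + #|B|].
  have [le1|lt1] := leqP (#|A| - 2 * #|B|) k; first by exists #|A|; split; lia.
  by exists (k + 2 * #|B|); split; lia.
have [ps [szA rA pA]] := covA j le_j.
have [||||||ps' [sz' r' p']] := @absorb A (A :|: B) (enum B) ps k (subsetUl _ _).
- by move=> b; rewrite mem_enum inE => ->; rewrite orbT.
- by move=> b; rewrite mem_enum => Bb u Au; apply: domAB.
- exact: rA.
- by rewrite -cardE szA.
- exact: k_gt0.
- by rewrite -cardE szA.
exists ps'; split=> //; rewrite (permPl p') -(permPr (perm_fibersU dAB)).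
by rewrite perm_cat2l.
Qed.

(** One vertex [b] of [B] is kept back to close the cycle, while the others merge the paths. *)
Lemma hamiltonian_join A B j : [disjoint A & B] -> A :|: B = setT ->
  {in B & A, forall b u, adj b u} -> 0 < #|B| <= j -> j <= 2 * #|B| ->
  coverable A j -> hamiltonian (prism G).
Proof.
move=> dAB AB domAB leBj lejB [ps [szA rA pA]].
suff [p [sz_p cyc_p perm_p]] : exists p, [/\ 2 < size p, cycle (@adj _) p &
    perm_eq p (fibers (enum B) ++ flatten ps)].
  have {}perm_p : perm_eq p (fibers (enum [set: G])).
    by rewrite -AB -(permPr (perm_fibersU dAB)) (permPl perm_p) perm_cat2l.
  exists p; split=> //.
    by rewrite (perm_uniq perm_p) uniq_fibers ?enum_uniq.
  by move=> x; rewrite (perm_mem perm_p) mem_fibers mem_enum inE.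
have domB b : b \in enum B -> dominates A b.
  by rewrite mem_enum => Bb u Au; apply: domAB.
have := cardE B; case: (enum B) domB => [|b bs] /= domB szB; first by lia.
have domb : dominates A b by apply: domB; rewrite mem_head.
have dom_bs : {in bs, forall b, dominates A b}.
  by move=> c c_bs; apply: domB; rewrite inE c_bs orbT.
(* The other vertices remove at most [2 * #|B| - 2] paths. If one path can be reached, the fiber of
   [b] closes it; if [j = 2 * #|B|], two paths remain, the second is reversed, and each copy of [b]
   links them at one level. *)
have [ltj|gej] := ltnP j (2 * #|B|).
  have [|||ps' [sz' r' perm']] := @absorb_all A bs ps 1 dom_bs rA.
  - by lia.
  - by [].
  - by lia.
  case: ps' sz' r' perm' => [|p []] //= _ r' perm'.
  have [u [v [Au Av Puv]]] := r' p (mem_head _ _).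
  have Pb := path_between_cat (path_between1 (high b)) (path_between1 (low b)).
  exists (p ++ [:: high b] ++ [:: low b]); split.
  - by have [q [-> _ _]] := Puv; rewrite /= size_cat /=; lia.
  - apply: path_between_cycle (path_between_cat Puv (Pb _) _) _.
    + by rewrite adj_sym adj_low_high.
    + by rewrite adj_high adj_sym domb.
    + by rewrite adj_low domb.
  apply/permP => a; move/permP/(_ a): perm'; rewrite /fibers /= ?count_cat /= ?count_cat /=.
  by lia.
have [|||ps' [sz' r' perm']] := @absorb_all A bs ps 2 dom_bs rA.
- by lia.
- by [].
- by lia.
case: ps' sz' r' perm' => [|p1 [|p2 []]] //= _ r' perm'.
have [u1 [v1 [Au1 Av1 P1]]] := r' p1 (mem_head _ _).
have [|u2 [v2 [Au2 Av2 P2]]] := r' p2; first by rewrite !inE eqxx orbT.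
have P2' := path_between_cat (path_between_rev P2) (path_between1 (low b)).
have P2'' := path_between_cat (path_between1 (high b)) (P2' _).
exists (p1 ++ [:: high b] ++ rev p2 ++ [:: low b]); split.
- by have [q [-> _ _]] := P1; rewrite /= !size_cat /= size_cat /=; lia.
- apply: path_between_cycle (path_between_cat P1 (P2'' _ _) _) _.
  + by rewrite adj_low adj_sym domb.
  + by rewrite adj_high domb.
  + by rewrite adj_high adj_sym domb.
  + by rewrite adj_low domb.
apply/permP => a; move/permP/(_ a): perm'.
by rewrite /fibers /= ?count_cat /= ?count_cat count_rev /=; lia.
Qed.

Lemma coverable_separated A : P4_free (@adj G) -> A != set0 ->
  exists q (S : {set G}), [/\ 0 < q <= #|A|, S \subset A,
    separated (A :\: S) (q + 2 * #|S|) &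
    forall k, q <= k <= #|A| -> coverable A k].
Proof.
move=> P4G; move: {2}#|A| (leqnn #|A|) => n; elim: n A => [|n IH] A leA A0.
  by move: A0; rewrite -card_gt0; lia.
have cardA0 : 0 < #|A| by rewrite card_gt0.
have [A1|A1] := leqP #|A| 1.
  have /cards1P[v ->] : #|A| == 1 by lia.
  exists 1, set0; split; rewrite ?cards1 ?sub0set //.
    by rewrite setD0 cards0; apply: (separated1 (set11 v)).
  by move=> k le_k; have -> : k = 1 by [lia]; apply: coverable1.
have [X [Y splitXY]] := P4_free_splits (@adj_sym G) P4G A1.
have [X0 Y0 XY dXY] : [/\ X != set0, Y != set0, X :|: Y = A & [disjoint X & Y]].
  by case: splitXY => [] [].
have cardX0 : 0 < #|X| by rewrite card_gt0.
have cardY0 : 0 < #|Y| by rewrite card_gt0.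
have cardXY : #|A| = #|X| + #|Y|.
  by rewrite -XY cardsU (disjoint_setI0 dXY) cards0 subn0.
case: splitXY => [[_ _ _ _ nXY]|[_ _ _ _ aXY]].
  have [||qX [SX [leX sX sepX covX]]] := IH X; [by lia|by []|].
  have [||qY [SY [leY sY sepY covY]]] := IH Y; [by lia|by []|].
  have disjoint_sub (U V : {set G}) : U \subset X -> V \subset Y -> [disjoint U & V].
    by move=> sU sV; exact: disjointW sU sV dXY.
  exists (qX + qY), (SX :|: SY); split; first by lia.
  - by rewrite -XY setUSS.
  - have -> : A :\: (SX :|: SY) = (X :\: SX) :|: (Y :\: SY).
      apply/setP=> v; rewrite -XY !inE negb_or; have [Xv|nXv] := boolP (v \in X).
        have nYv : v \notin Y by rewrite (disjointFr dXY Xv).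
        by rewrite (negPf nYv) (contraNN (subsetP sY v) nYv) !andbT andbF !orbF.
      by rewrite (contraNN (subsetP sX v) nXv) andbF.
    rewrite cardsU (disjoint_setI0 (disjoint_sub _ _ sX sY)) cards0 subn0.
    have -> : qX + qY + 2 * (#|SX| + #|SY|) =
        (qX + 2 * #|SX|) + (qY + 2 * #|SY|) by lia.
    apply: separatedU => //; first by rewrite disjoint_sub ?subsetDl.
    by move=> x y /setDP[Xx _] /setDP[Yy _]; apply: nXY.
  - move=> k le_k; rewrite -XY.
    (* As many paths over [X] as possible, leaving at least [qY] for [Y]. *)
    pose k1 := minn #|X| (k - qY).
    have -> : k = k1 + (k - k1) by lia.
    by apply: coverableU => //; [apply: covX | apply: covY]; lia.
have {aXY} : {in X & Y, forall u v, adj u v}.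
  by move=> x y Xx Yy; have := aXY x y Xx Yy; rewrite /rel_compl negbK.
wlog leYX : X Y X0 Y0 XY dXY cardX0 cardY0 cardXY / #|Y| <= #|X|.
  move=> H aXY; have [|/ltnW] := leqP #|Y| #|X|; first by move/H; apply.
  move/(H Y X); apply; rewrite 1?setUC 1?disjoint_sym 1?addnC //.
  by move=> x y Yx Xy; rewrite adj_sym aXY.
move=> aXY.
have aYX : {in Y & X, forall u v, adj u v}.
  by move=> x y Yx Xy; rewrite adj_sym aXY.
have [||q [S [leq sS sep cov]]] := IH X; [by lia|by []|].
have cov' k : 0 < k -> q - 2 * #|Y| <= k <= #|A| -> coverable A k.
  move=> k_gt0 le_k; rewrite -XY; apply: (@coverable_join X Y k q) => //; lia.
(* If [Y] can merge everything into one path, the nonemptiness of [A] is certificate enough. *)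
have [le_q|gt_q] := leqP q (2 * #|Y|).
  exists 1, set0; split; rewrite ?sub0set //.
    by rewrite setD0 cards0; have [v Av] := set0Pn _ A0; apply: (separated1 Av).
  by move=> k le_k; apply: cov'; lia.
(* Adding [Y] to the separator leaves the same pieces of [X]; the loss in [q] is balanced by the
   gain in [2 * #|S|]. *)
exists (q - 2 * #|Y|), (S :|: Y); split; first by lia.
- by rewrite -XY setSU.
- have -> : A :\: (S :|: Y) = X :\: S.
    rewrite setUC -setDDl -XY setDUl setDv setU0; congr (_ :\: _).
    exact/setDidPl.
  rewrite cardsU (disjoint_setI0 (disjointWl sS dXY)) cards0 subn0.
  by have -> : q - 2 * #|Y| + 2 * (#|S| + #|Y|) = q + 2 * #|S| by lia.
- by move=> k le_k; apply: cov'; lia.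
Qed.

End PrismPaths.

(** * Toughness in natural numbers, and the equivalence *)

Import GRing.Theory Num.Theory.

Lemma tough_half_nat (R : realType) (G : sgraph) :
  tough (2%:R^-1 : R)%R G <->
  forall S : {set G}, 1 < num_components (delete S) ->
    num_components (delete S) <= 2 * #|S|.
Proof.
have eqS (c s : nat) : (2%:R^-1 * c%:R <= s%:R :> R)%R = (c <= 2 * s).
  by rewrite ler_pdivrMl ?ltr0n // -natrM ler_nat.
by split=> H S /H; rewrite eqS.
Qed.

Theorem theorem1p5 (R : realType) (G : sgraph) :
  1 < #|G| -> induced_free (path_graph 4) G ->
  (hamiltonian (prism G) <-> tough (2%:R^-1 : R)%R G).
Proof.
move=> G_gt1 /induced_P4_free P4G; rewrite tough_half_nat.
split=> [ham S comp|toughG].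
  by rewrite mulnC hamiltonian_prism_num_components.
have small (S : {set G}) t : separated (~: S) t -> 1 < t -> t <= 2 * #|S|.
  move=> /separated_leq_num_components le_t t_gt1.
  by apply: (leq_trans le_t); apply: toughG; apply: leq_trans le_t.
have [|X [Y splitXY]] := P4_free_splits (A := setT) (@adj_sym G) P4G.
  by rewrite cardsT.
have [X0 Y0 XY dXY] :
    [/\ X != set0, Y != set0, X :|: Y = setT & [disjoint X & Y]].
  by case: splitXY => [] [].
case: splitXY => [[_ _ _ _ nXY]|[_ _ _ _ aXY]].
  (* If [G] is disconnected, the empty set already violates toughness. *)
  have [x Xx] := set0Pn _ X0; have [y Yy] := set0Pn _ Y0.
  have := separatedU dXY nXY (separated1 Xx) (separated1 Yy).
  by rewrite XY -setC0 => /small/(_ isT); rewrite cards0.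
have {aXY} : {in X & Y, forall u v, adj u v}.
  by move=> x y Xx Yy; have := aXY x y Xx Yy; rewrite /rel_compl negbK.
wlog leYX : X Y X0 Y0 XY dXY / #|Y| <= #|X|.
  move=> H aXY; have [|/ltnW] := leqP #|Y| #|X|; first by move/H; apply.
  move/(H Y X); apply; rewrite 1?setUC 1?disjoint_sym //.
  by move=> x y Yx Xy; rewrite adj_sym aXY.
move=> aXY.
have [q [S [le_q sS sep cov]]] := coverable_separated P4G X0.
have cardY0 : 0 < #|Y| by rewrite card_gt0.
(* Otherwise deleting [S :|: Y] would leave at least [q + 2 * #|S|] components, more than twice its
   size. *)
have q_le : q <= 2 * #|Y|.
  have defC : X :\: S = ~: (S :|: Y).
    apply/setP=> v; have := in_setT v; rewrite -XY !inE negb_or.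
    have [Xv|_ /= ->] := boolP (v \in X); last by rewrite !andbF.
    by rewrite (disjointFr dXY Xv) andbT.
  rewrite leqNgt; apply/negP => q_gt; move: sep; rewrite defC => /small.
  rewrite cardsU (disjoint_setI0 (disjointWl sS dXY)) cards0 subn0.
  by lia.
(* This number lies both in [[q, #|X|]], where covers exist, and in [[#|Y|, 2 * #|Y|]], where [Y]
   can close them up. *)
apply: (@hamiltonian_join G X Y (minn #|X| (2 * #|Y|))) => //.
- by move=> x y Yx Xy; rewrite adj_sym aXY.
- by lia.
- by lia.
- by apply: cov; lia.
Qed.
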